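(* Let $\mathcal L$: $u_t=A(t,x)u_{xx}+B(t,x)u_x+C(t,x)u$ with analytic $A,B,C$, $A\ne0$. Every reduction operator of $\mathcal L$ is equivalent to either an operator $$\partial_t+g^1(t,x)\partial_x+(g^2(t,x)u+g^3(t,x))\partial_u,$$ where the functions $g^1,g^2,g^3$ of $(t,x)$ satisfy the system $$g^1_t-Ag^1_{xx}-Bg^1_x+\Bigl(2g^1_x-\tfrac{A_x}{A}g^1-\tfrac{A_t}{A}\Bigr)(g^1+B)+B_xg^1+2Ag^2_x+B_t=0,$$ $$g^2_t-Ag^2_{xx}-Bg^2_x+\Bigl(2g^1_x-\tfrac{A_x}{A}g^1-\tfrac{A_t}{A}\Bigr)(g^2-C)-C_xg^1-C_t=0,$$ $$g^3_t-Ag^3_{xx}-Bg^3_x+\Bigl(2g^1_x-\tfrac{A_x}{A}g^1-\tfrac{A_t}{A}\Bigr)g^3-Cg^3=0,$$ or an operator $\partial_x+\eta(t,x,u)\partial_u$, where the function $\eta=\eta(t,x,u)$ is a solution of the equation $$\eta_t=A(\eta_{xx}+2\eta\eta_{xu}+\eta^2\eta_{uu})+A_x(\eta_x+\eta\eta_u)+(B\eta)_x+C(\eta-u\eta_u)+C_xu.$$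
   Context: All considerations are local: functions are smooth (or analytic) on a suitable domain, which may be shrunk so that expressions not vanishing identically do not vanish. Write $Lu:=u_t-Au_{xx}-Bu_x-Cu$. A reduction operator (nonclassical symmetry) of $\mathcal L$ is an operator $Q=\tau\partial_t+\xi\partial_x+\eta\partial_u$ with coefficients depending on $(t,x,u)$, $(\tau,\xi)\ne(0,0)$, such that $Q_{(2)}(Lu)=0$ holds on the subset of the second-order jet space defined by $Lu=0$, $Q[u]=0$, $D_tQ[u]=0$, $D_xQ[u]=0$. Here $Q[u]=\eta-\tau u_t-\xi u_x$ is the characteristic of $Q$, $Q_{(2)}$ is the standard second prolongation of $Q$, and $D_t,D_x$ are total derivatives. Two operators are equivalent if they differ by a nonvanishing multiplier $\lambda(t,x,u)$. *)

(* Defs.v *)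
From Stdlib Require Import Reals.
From Coquelicot Require Import Coquelicot.
Set Implicit Arguments.
Open Scope R_scope.

(** Stdlib reals with Coquelicot.  Points of the (t,x)-plane have type [R * R],
    points of the (t,x,u)-space have type [R * R * R]; Coquelicot's [ball] on
    these types is an open cube. *)

Definition pdt2 (g : R -> R -> R) (t x : R) : R := Derive (fun s => g s x) t.
Definition pdx2 (g : R -> R -> R) (t x : R) : R := Derive (fun s => g t s) x.

Definition pdt (f : R -> R -> R -> R) (t x u : R) : R := Derive (fun s => f s x u) t.
Definition pdx (f : R -> R -> R -> R) (t x u : R) : R := Derive (fun s => f t s u) x.
Definition pdu (f : R -> R -> R -> R) (t x u : R) : R := Derive (fun s => f t x s) u.

(** Class C^k on [W]; meant for open [W], since [Derive] looks at a full
    neighbourhood. *)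
Fixpoint Ck (k : nat) (W : R * R * R -> Prop) (f : R -> R -> R -> R) : Prop :=
  (forall t x u, W (t, x, u) ->
     continuous (fun p : R * R * R => f (fst (fst p)) (snd (fst p)) (snd p)) (t, x, u))
  /\ match k with
     | O => True
     | S m =>
         (forall t x u, W (t, x, u) ->
            ex_derive (fun s => f s x u) t /\
            ex_derive (fun s => f t s u) x /\
            ex_derive (fun s => f t x s) u)
         /\ Ck m W (pdt f) /\ Ck m W (pdx f) /\ Ck m W (pdu f)
     end.

Definition smooth (W : R * R * R -> Prop) (f : R -> R -> R -> R) : Prop :=
  forall k, Ck k W f.

(** A function of (t,x) on [D] is viewed as a function on [D] x R that does not
    depend on u. *)
Definition smooth2 (D : R * R -> Prop) (g : R -> R -> R) : Prop :=
  smooth (fun p => D (fst p)) (fun t x _ => g t x).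

(** Real analyticity: around each point [g] is the sum of a double power series
    with coefficients [a i j], grouped by total degree; the first condition is
    absolute convergence at (r,r). *)
Definition analytic2 (D : R * R -> Prop) (g : R -> R -> R) : Prop :=
  forall t0 x0, D (t0, x0) ->
  exists (a : nat -> nat -> R) (r : R), 0 < r /\
    ex_series (fun n => sum_n (fun i => Rabs (a i (n - i)%nat)) n * r ^ n) /\
    forall t x, Rabs (t - t0) < r -> Rabs (x - x0) < r ->
      is_series
        (fun n => sum_n (fun i => a i (n - i)%nat * (t - t0) ^ i * (x - x0) ^ (n - i)) n)
        (g t x).

(** Functions on the jet spaces J^1 and J^2 of one dependent variable u and two
    independent variables t, x; the arguments are, in this order,
    t, x, u, u_t, u_x, and for J^2 in addition u_tt, u_tx, u_xx. *)
Definition jfun1 := R -> R -> R -> R -> R -> R.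
Definition jfun2 := R -> R -> R -> R -> R -> R -> R -> R -> R.

(** Total derivatives, from functions on J^0 to functions on J^1, and from
    functions on J^1 to functions on J^2. *)
Definition Dt0 (f : R -> R -> R -> R) : jfun1 :=
  fun t x u ut ux => pdt f t x u + ut * pdu f t x u.
Definition Dx0 (f : R -> R -> R -> R) : jfun1 :=
  fun t x u ut ux => pdx f t x u + ux * pdu f t x u.

Definition Dt1 (F : jfun1) : jfun2 :=
  fun t x u ut ux utt utx uxx =>
    Derive (fun s => F s x u ut ux) t
    + ut * Derive (fun s => F t x s ut ux) u
    + utt * Derive (fun s => F t x u s ux) ut
    + utx * Derive (fun s => F t x u ut s) ux.
Definition Dx1 (F : jfun1) : jfun2 :=
  fun t x u ut ux utt utx uxx =>
    Derive (fun s => F t s u ut ux) x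
    + ux * Derive (fun s => F t x s ut ux) u
    + utx * Derive (fun s => F t x u s ux) ut
    + uxx * Derive (fun s => F t x u ut s) ux.

(** [Operator tau xi eta] is tau d/dt + xi d/dx + eta d/du. *)
Record operator := Operator {
  tau : R -> R -> R -> R;
  xi : R -> R -> R -> R;
  eta : R -> R -> R -> R }.

Definition characteristic (Q : operator) : jfun1 :=
  fun t x u ut ux => eta Q t x u - tau Q t x u * ut - xi Q t x u * ux.

(** Coefficients of the second prolongation, by the standard recursion
    eta^(J,i) = D_i eta^J - u_(J,t) D_i tau - u_(J,x) D_i xi. *)
Definition eta_t (Q : operator) : jfun1 :=
  fun t x u ut ux =>
    Dt0 (eta Q) t x u ut ux - ut * Dt0 (tau Q) t x u ut ux - ux * Dt0 (xi Q) t x u ut ux.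
Definition eta_x (Q : operator) : jfun1 :=
  fun t x u ut ux =>
    Dx0 (eta Q) t x u ut ux - ut * Dx0 (tau Q) t x u ut ux - ux * Dx0 (xi Q) t x u ut ux.
Definition eta_tt (Q : operator) : jfun2 :=
  fun t x u ut ux utt utx uxx =>
    Dt1 (eta_t Q) t x u ut ux utt utx uxx
    - utt * Dt0 (tau Q) t x u ut ux - utx * Dt0 (xi Q) t x u ut ux.
Definition eta_tx (Q : operator) : jfun2 :=
  fun t x u ut ux utt utx uxx =>
    Dx1 (eta_t Q) t x u ut ux utt utx uxx
    - utt * Dx0 (tau Q) t x u ut ux - utx * Dx0 (xi Q) t x u ut ux.
Definition eta_xx (Q : operator) : jfun2 :=
  fun t x u ut ux utt utx uxx =>
    Dx1 (eta_x Q) t x u ut ux utt utx uxx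
    - utx * Dx0 (tau Q) t x u ut ux - uxx * Dx0 (xi Q) t x u ut ux.

Definition prolongation2 (Q : operator) (F : jfun2) : jfun2 :=
  fun t x u ut ux utt utx uxx =>
    tau Q t x u * Derive (fun s => F s x u ut ux utt utx uxx) t
    + xi Q t x u * Derive (fun s => F t s u ut ux utt utx uxx) x
    + eta Q t x u * Derive (fun s => F t x s ut ux utt utx uxx) u
    + eta_t Q t x u ut ux * Derive (fun s => F t x u s ux utt utx uxx) ut
    + eta_x Q t x u ut ux * Derive (fun s => F t x u ut s utt utx uxx) ux
    + eta_tt Q t x u ut ux utt utx uxx * Derive (fun s => F t x u ut ux s utx uxx) utt
    + eta_tx Q t x u ut ux utt utx uxx * Derive (fun s => F t x u ut ux utt s uxx) utx
    + eta_xx Q t x u ut ux utt utx uxx * Derive (fun s => F t x u ut ux utt utx s) uxx.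

Definition Lop (A B C : R -> R -> R) : jfun2 :=
  fun t x u ut ux utt utx uxx => ut - A t x * uxx - B t x * ux - C t x * u.

(** Nonclassical symmetry on the open set [W] of the (t,x,u)-space.  The
    condition (tau,xi) <> (0,0) is that of functions: tau and xi do not both
    vanish identically on [W]. *)
Definition reduction_operator (A B C : R -> R -> R) (W : R * R * R -> Prop)
    (Q : operator) : Prop :=
  smooth W (tau Q) /\ smooth W (xi Q) /\ smooth W (eta Q) /\
  (exists t x u, W (t, x, u) /\ (tau Q t x u <> 0 \/ xi Q t x u <> 0)) /\
  forall t x u ut ux utt utx uxx : R,
    W (t, x, u) ->
    Lop A B C t x u ut ux utt utx uxx = 0 ->
    characteristic Q t x u ut ux = 0 ->
    Dt1 (characteristic Q) t x u ut ux utt utx uxx = 0 ->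
    Dx1 (characteristic Q) t x u ut ux utt utx uxx = 0 ->
    prolongation2 Q (Lop A B C) t x u ut ux utt utx uxx = 0.

Definition equivalent_on (W : R * R * R -> Prop) (Q Q' : operator) : Prop :=
  exists lambda : R -> R -> R -> R,
    smooth W lambda /\
    forall t x u, W (t, x, u) ->
      lambda t x u <> 0 /\
      tau Q' t x u = lambda t x u * tau Q t x u /\
      xi Q' t x u = lambda t x u * xi Q t x u /\
      eta Q' t x u = lambda t x u * eta Q t x u.

Definition g_factor (A g1 : R -> R -> R) (t x : R) : R :=
  2 * pdx2 g1 t x - pdx2 A t x / A t x * g1 t x - pdt2 A t x / A t x.

Definition g_system (A B C g1 g2 g3 : R -> R -> R) (t x : R) : Prop :=
  pdt2 g1 t x - A t x * pdx2 (pdx2 g1) t x - B t x * pdx2 g1 t x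
    + g_factor A g1 t x * (g1 t x + B t x)
    + pdx2 B t x * g1 t x + 2 * A t x * pdx2 g2 t x + pdt2 B t x = 0 /\
  pdt2 g2 t x - A t x * pdx2 (pdx2 g2) t x - B t x * pdx2 g2 t x
    + g_factor A g1 t x * (g2 t x - C t x)
    - pdx2 C t x * g1 t x - pdt2 C t x = 0 /\
  pdt2 g3 t x - A t x * pdx2 (pdx2 g3) t x - B t x * pdx2 g3 t x
    + g_factor A g1 t x * g3 t x - C t x * g3 t x = 0.

Definition eta_equation (A B C : R -> R -> R) (h : R -> R -> R -> R) (t x u : R) : Prop :=
  pdt h t x u =
    A t x * (pdx (pdx h) t x u + 2 * h t x u * pdu (pdx h) t x u
             + (h t x u) ^ 2 * pdu (pdu h) t x u)
    + pdx2 A t x * (pdx h t x u + h t x u * pdu h t x u)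
    + pdx (fun t x u => B t x * h t x u) t x u
    + C t x * (h t x u - u * pdu h t x u)
    + pdx2 C t x * u.

(* Main.v *)
Require Import Defs.
From Stdlib Require Import Reals.
From Coquelicot Require Import Coquelicot.
From Stdlib Require Import Lra Lia Classical FunctionalExtensionality.
Open Scope R_scope.

(** The invariance criterion is compatible with multiplying Q by a nonvanishing
    function, so near a point where tau is nonzero one may take tau = 1, and near
    a point around which tau vanishes identically one may take tau = 0, xi = 1.
    If tau = 1, eliminating u_t, u_tx and u_xx turns the criterion into a cubic
    polynomial in u_x.  Its u_x^3 and u_x^2 coefficients make xi affine and eta
    cubic in u, and the u^3 part of the u_x coefficient then forces xi_u = 0; hence
    eta is affine in u, and the remaining coefficients are the system for
    g1, g2, g3.  If tau = 0, no free jet variable is left and the criterion is the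
    equation for eta. *)

(** * Smooth functions *)

(** The jet variables range over all of R, whereas u is confined to a possibly short interval. So
    the coefficients of the polynomial in u_x are isolated by substituting numbers, while every
    statement about the dependence on u is reached by differentiating identities that hold on an
    open set. Since A, B, C do not depend on u, they behave as constants under these
    differentiations. The balls of the product space are cubes: each meets a line in the u-direction
    in an interval and contains the slice through its centre. This turns vanishing u-derivatives
    into independence of u, and lets g1, g2, g3 be read off on that slice. tau may vanish at the
    given point and still be nonzero at points arbitrarily near it. The ball that carries the normal
    form is therefore centred at some point close to the given one, not always at the given one. *)

Lemma locally_line_t (W : R * R * R -> Prop) (t x u : R) :
  locally (t, x, u) W -> locally t (fun s => W (s, x, u)).
Proof.
intros [e He]; exists e; intros s Hs; apply He.
repeat split; simpl; auto using ball_center.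
Qed.

Lemma locally_line_x (W : R * R * R -> Prop) (t x u : R) :
  locally (t, x, u) W -> locally x (fun s => W (t, s, u)).
Proof.
intros [e He]; exists e; intros s Hs; apply He.
repeat split; simpl; auto using ball_center.
Qed.

Lemma locally_line_u (W : R * R * R -> Prop) (t x u : R) :
  locally (t, x, u) W -> locally u (fun s => W (t, x, s)).
Proof.
intros [e He]; exists e; intros s Hs; apply He.
repeat split; simpl; auto using ball_center.
Qed.

(** The axioms of a uniform space do not make balls open, so openness is derived from the order on R
    and then passed to products componentwise. *)
Lemma open_ball_R (x r : R) : open (ball x r).
Proof.
apply open_ext with (fun y => x - r < y /\ y < x + r).
{ intros y; split.
  - intros [H1 H2]. apply Rabs_def1; unfold minus, plus, opp; simpl; lra.
  - intros H. apply Rabs_def2 in H. unfold minus, plus, opp in H; simpl in H; lra. }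
apply open_and; [apply open_gt | apply open_lt].
Qed.

Lemma open_ball_R2 (p : R * R) (r : R) : open (ball p r).
Proof.
intros q [H1 H2].
destruct (open_ball_R _ _ _ H1) as [e1 He1], (open_ball_R _ _ _ H2) as [e2 He2].
exists (mkposreal _ (Rmin_stable_in_posreal e1 e2)); intros z [Hz1 Hz2]; split.
- apply He1, (ball_le _ _ _ (Rmin_l e1 e2)), Hz1.
- apply He2, (ball_le _ _ _ (Rmin_r e1 e2)), Hz2.
Qed.

Lemma open_ball_R3 (p : R * R * R) (r : R) : open (ball p r).
Proof.
intros q [H1 H2].
destruct (open_ball_R2 _ _ _ H1) as [e1 He1], (open_ball_R _ _ _ H2) as [e2 He2].
exists (mkposreal _ (Rmin_stable_in_posreal e1 e2)); intros z [Hz1 Hz2]; split.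
- apply He1, (ball_le _ _ _ (Rmin_l e1 e2)), Hz1.
- apply He2, (ball_le _ _ _ (Rmin_r e1 e2)), Hz2.
Qed.

Lemma Ck_mono (k : nat) : forall (V W : R * R * R -> Prop) f,
  (forall q, V q -> W q) -> Ck k W f -> Ck k V f.
Proof.
induction k as [|k IH]; intros V W f HVW.
- intros [H _]; split; auto.
- intros (H & He & Ht & Hx & Hu).
  split; [auto|split; [auto|]].
  repeat split; apply (IH V W); assumption.
Qed.

(** The derivative of a product or of an inverse still contains undifferentiated factors; the
    inductions on [k] need those to be of class C^k as well. *)
Lemma Ck_S (k : nat) : forall W f, Ck (S k) W f -> Ck k W f.
Proof.
induction k as [|k IH]; intros W f (H & He & Ht & Hx & Hu); (split; [exact H|]).
- exact I.
- split; [exact He|]. repeat split; apply IH; assumption.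
Qed.

Section Open_domain.
Variable W : R * R * R -> Prop.
Hypothesis hW : open W.

Lemma pd_ext_open (f g : R -> R -> R -> R) (t x u : R) :
  (forall t x u, W (t, x, u) -> f t x u = g t x u) -> W (t, x, u) ->
  pdt f t x u = pdt g t x u /\ pdx f t x u = pdx g t x u /\
  pdu f t x u = pdu g t x u.
Proof.
intros E H; apply hW in H.
split; [|split]; apply Derive_ext_loc.
- generalize (locally_line_t _ _ _ _ H); apply filter_imp; auto.
- generalize (locally_line_x _ _ _ _ H); apply filter_imp; auto.
- generalize (locally_line_u _ _ _ _ H); apply filter_imp; auto.
Qed.

(** The formulas for derivatives of sums, products and inverses hold only where the factors are
    differentiable, that is on [W], so membership in C^k has to be transferable along equality on
    [W] alone. *)
Lemma Ck_ext (k : nat) : forall f g : R -> R -> R -> R,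
  (forall t x u, W (t, x, u) -> f t x u = g t x u) -> Ck k W f -> Ck k W g.
Proof.
assert (Hc : forall f g : R -> R -> R -> R,
  (forall t x u, W (t, x, u) -> f t x u = g t x u) ->
  (forall t x u, W (t, x, u) -> continuous
    (fun p : R * R * R => f (fst (fst p)) (snd (fst p)) (snd p)) (t, x, u)) ->
  (forall t x u, W (t, x, u) -> continuous
    (fun p : R * R * R => g (fst (fst p)) (snd (fst p)) (snd p)) (t, x, u))).
{ intros f g E H t x u Hw.
  eapply continuous_ext_loc; [|apply H, Hw].
  generalize (hW _ Hw); apply filter_imp.
  intros [[t' x'] u']; apply E. }
induction k as [|k IH]; intros f g E.
- intros [H _]; split; [eapply Hc; eauto|exact I].
- intros (H & He & Ht & Hx & Hu).
  split; [eapply Hc; eauto|].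
  split.
  { intros t x u Hw; destruct (He t x u Hw) as (H1 & H2 & H3).
    apply hW in Hw. split; [|split].
    - revert H1; apply ex_derive_ext_loc.
      generalize (locally_line_t _ _ _ _ Hw); apply filter_imp; auto.
    - revert H2; apply ex_derive_ext_loc.
      generalize (locally_line_x _ _ _ _ Hw); apply filter_imp; auto.
    - revert H3; apply ex_derive_ext_loc.
      generalize (locally_line_u _ _ _ _ Hw); apply filter_imp; auto. }
  repeat split; [apply (IH (pdt f)) | apply (IH (pdx f)) | apply (IH (pdu f))];
    try assumption; intros t x u Hw; apply (pd_ext_open _ _ _ _ _ E Hw).
Qed.

Lemma Ck_const (k : nat) : forall c : R, Ck k W (fun _ _ _ => c).
Proof.
induction k as [|k IH]; intros c.
- split; [|exact I]. intros; apply continuous_const.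
- split; [intros; apply continuous_const|].
  split; [intros; repeat split; apply ex_derive_const|].
  repeat split; (apply Ck_ext with (fun _ _ _ => 0); [|apply IH]);
    intros; exact (eq_sym (Derive_const c _)).
Qed.

Lemma Ck_plus (k : nat) : forall f g : R -> R -> R -> R, Ck k W f -> Ck k W g ->
  Ck k W (fun t x u => f t x u + g t x u).
Proof.
induction k as [|k IH]; intros f g.
- intros [Hf _] [Hg _]; split; [|exact I].
  intros t x u Hw; apply (continuous_plus (K := R_AbsRing) (V := R_NormedModule)); auto.
- intros (Hf & Ef & Ft & Fx & Fu) (Hg & Eg & Gt & Gx & Gu).
  split; [intros t x u Hw; apply (continuous_plus (K := R_AbsRing) (V := R_NormedModule)); auto|].
  split.
  { intros t x u Hw; destruct (Ef _ _ _ Hw) as (?&?&?), (Eg _ _ _ Hw) as (?&?&?).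
    repeat split; auto_derive; auto. }
  repeat split;
    [apply (Ck_ext k (fun t x u => pdt f t x u + pdt g t x u))
    |apply (Ck_ext k (fun t x u => pdx f t x u + pdx g t x u))
    |apply (Ck_ext k (fun t x u => pdu f t x u + pdu g t x u))]; auto;
  intros t x u Hw; destruct (Ef _ _ _ Hw) as (?&?&?), (Eg _ _ _ Hw) as (?&?&?);
  symmetry; apply Derive_plus; assumption.
Qed.

Lemma Ck_mult (k : nat) : forall f g : R -> R -> R -> R, Ck k W f -> Ck k W g ->
  Ck k W (fun t x u => f t x u * g t x u).
Proof.
induction k as [|k IH]; intros f g HF HG.
- destruct HF as [Hf _], HG as [Hg _]; split; [|exact I].
  intros t x u Hw; apply (continuous_mult (K := R_AbsRing)); auto.
- assert (HF' := Ck_S _ _ _ HF). assert (HG' := Ck_S _ _ _ HG).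
  destruct HF as (Hf & Ef & Ft & Fx & Fu), HG as (Hg & Eg & Gt & Gx & Gu).
  split; [intros t x u Hw; apply (continuous_mult (K := R_AbsRing)); auto|].
  split.
  { intros t x u Hw; destruct (Ef _ _ _ Hw) as (?&?&?), (Eg _ _ _ Hw) as (?&?&?).
    repeat split; auto_derive; auto. }
  repeat split;
    [apply (Ck_ext k (fun t x u => pdt f t x u * g t x u + f t x u * pdt g t x u))
    |apply (Ck_ext k (fun t x u => pdx f t x u * g t x u + f t x u * pdx g t x u))
    |apply (Ck_ext k (fun t x u => pdu f t x u * g t x u + f t x u * pdu g t x u))];
  try (apply Ck_plus; apply IH; assumption);
  intros t x u Hw; destruct (Ef _ _ _ Hw) as (?&?&?), (Eg _ _ _ Hw) as (?&?&?);
  symmetry; apply Derive_mult; assumption.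
Qed.

Lemma Ck_inv (k : nat) : forall f : R -> R -> R -> R,
  (forall t x u, W (t, x, u) -> f t x u <> 0) -> Ck k W f ->
  Ck k W (fun t x u => / f t x u).
Proof.
induction k as [|k IH]; intros f N HF.
- destruct HF as [Hf _]; split; [|exact I].
  intros t x u Hw; apply (continuous_comp _ Rinv); [auto|].
  apply continuous_Rinv, (N _ _ _ Hw).
- assert (HF' := Ck_S _ _ _ HF).
  destruct HF as (Hf & Ef & Ft & Fx & Fu).
  split.
  { intros t x u Hw; apply (continuous_comp _ Rinv); [auto|].
    apply continuous_Rinv, (N _ _ _ Hw). }
  split.
  { intros t x u Hw; destruct (Ef _ _ _ Hw) as (?&?&?).
    repeat split; auto_derive; auto. }
  (* The derivative -d/f^2 is written with products of inverses only, so that the induction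
     hypothesis for 1/f and [Ck_mult] apply. *)
  assert (A : forall d, Ck k W d ->
    Ck k W (fun t x u => d t x u * (-1 * (/ f t x u * / f t x u)))).
  { intros d Hd; apply Ck_mult; [exact Hd|].
    apply (Ck_mult k (fun _ _ _ => -1)); [apply Ck_const|].
    apply Ck_mult; apply IH; assumption. }
  repeat split;
    [generalize (A _ Ft)|generalize (A _ Fx)|generalize (A _ Fu)]; apply Ck_ext;
  intros t x u Hw; destruct (Ef _ _ _ Hw) as (?&?&?);
  assert (N' := N _ _ _ Hw); symmetry;
  (etransitivity; [apply Derive_inv; assumption|]); cbv beta; unfold pdt, pdx, pdu; try change (fun s => f t x s) with (f t x);
  field; exact N'.
Qed.

Lemma smooth_const (c : R) : smooth W (fun _ _ _ => c).
Proof. intros k; apply Ck_const. Qed.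

Lemma smooth_plus (f g : R -> R -> R -> R) : smooth W f -> smooth W g ->
  smooth W (fun t x u => f t x u + g t x u).
Proof. intros F G k; apply Ck_plus; auto. Qed.

Lemma smooth_mult (f g : R -> R -> R -> R) : smooth W f -> smooth W g ->
  smooth W (fun t x u => f t x u * g t x u).
Proof. intros F G k; apply Ck_mult; auto. Qed.

Lemma smooth_inv (f : R -> R -> R -> R) :
  (forall t x u, W (t, x, u) -> f t x u <> 0) -> smooth W f ->
  smooth W (fun t x u => / f t x u).
Proof. intros N F k; apply Ck_inv; auto. Qed.

Lemma smooth_pdt (f : R -> R -> R -> R) : smooth W f -> smooth W (pdt f).
Proof. intros F k; apply (F (S k)). Qed.

Lemma smooth_pdx (f : R -> R -> R -> R) : smooth W f -> smooth W (pdx f).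
Proof. intros F k; apply (F (S k)). Qed.

Lemma smooth_pdu (f : R -> R -> R -> R) : smooth W f -> smooth W (pdu f).
Proof. intros F k; apply (F (S k)). Qed.

Lemma smooth_ex_derive (f : R -> R -> R -> R) (t x u : R) :
  smooth W f -> W (t, x, u) ->
  ex_derive (fun s => f s x u) t /\ ex_derive (fun s => f t s u) x /\
  ex_derive (fun s => f t x s) u.
Proof. intros F; apply (F 1%nat). Qed.

Lemma smooth_continuous (f : R -> R -> R -> R) (t x u : R) :
  smooth W f -> W (t, x, u) ->
  continuous (fun p : R * R * R => f (fst (fst p)) (snd (fst p)) (snd p)) (t, x, u).
Proof. intros F; apply (F O). Qed.

(** Schwarz's theorem in the plane of constant t; the continuity of the mixed derivatives there is
    the joint continuity composed with the embedding of that plane. *)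
Lemma pdu_pdx_comm (f : R -> R -> R -> R) (t x u : R) :
  smooth W f -> W (t, x, u) -> pdu (pdx f) t x u = pdx (pdu f) t x u.
Proof.
intros F Hw.
assert (Hc : forall g : R -> R -> R -> R, smooth W g ->
  continuity_2d_pt (fun a b => g t a b) x u).
{ intros g G; apply continuity_2d_pt_filterlim.
  apply (continuous_comp (fun z : R * R => (t, fst z, snd z))
           (fun p : R * R * R => g (fst (fst p)) (snd (fst p)) (snd p)) (x, u)).
  - intros P [e He]; exists e; intros z [H1 H2]; apply He.
    repeat split; simpl; auto using ball_center.
  - apply (smooth_continuous _ _ _ _ G Hw). }
symmetry; apply (Schwarz (fun a b => f t a b)).
- apply locally_2d_locally.
  destruct (hW _ Hw) as [e He]; exists e; intros [a b] [H1 H2]; simpl.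
  assert (Hab : W (t, a, b)).
  { apply He; repeat split; auto using ball_center. }
  split; [|split; [|split]].
  + apply (smooth_ex_derive f _ _ _ F Hab).
  + apply (smooth_ex_derive f _ _ _ F Hab).
  + apply (smooth_ex_derive _ _ _ _ (smooth_pdu _ F) Hab).
  + apply (smooth_ex_derive _ _ _ _ (smooth_pdx _ F) Hab).
- apply (Hc (pdx (pdu f))); apply smooth_pdx, smooth_pdu, F.
- apply (Hc (pdu (pdx f))); apply smooth_pdu, smooth_pdx, F.
Qed.

Lemma pdu_pdt_comm (f : R -> R -> R -> R) (t x u : R) :
  smooth W f -> W (t, x, u) -> pdu (pdt f) t x u = pdt (pdu f) t x u.
Proof.
intros F Hw.
assert (Hc : forall g : R -> R -> R -> R, smooth W g ->
  continuity_2d_pt (fun a b => g a x b) t u).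
{ intros g G; apply continuity_2d_pt_filterlim.
  apply (continuous_comp (fun z : R * R => (fst z, x, snd z))
           (fun p : R * R * R => g (fst (fst p)) (snd (fst p)) (snd p)) (t, u)).
  - intros P [e He]; exists e; intros z [H1 H2]; apply He.
    repeat split; simpl; auto using ball_center.
  - apply (smooth_continuous _ _ _ _ G Hw). }
symmetry; apply (Schwarz (fun a b => f a x b)).
- apply locally_2d_locally.
  destruct (hW _ Hw) as [e He]; exists e; intros [a b] [H1 H2]; simpl.
  assert (Hab : W (a, x, b)).
  { apply He; repeat split; auto using ball_center. }
  split; [|split; [|split]].
  + apply (smooth_ex_derive f _ _ _ F Hab).
  + apply (smooth_ex_derive f _ _ _ F Hab).
  + apply (smooth_ex_derive _ _ _ _ (smooth_pdu _ F) Hab).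
  + apply (smooth_ex_derive _ _ _ _ (smooth_pdt _ F) Hab).
- apply (Hc (pdt (pdu f))); apply smooth_pdt, smooth_pdu, F.
- apply (Hc (pdu (pdt f))); apply smooth_pdu, smooth_pdt, F.
Qed.

End Open_domain.

Lemma smooth_mono (V W : R * R * R -> Prop) (f : R -> R -> R -> R) :
  (forall q, V q -> W q) -> smooth W f -> smooth V f.
Proof. intros H F k; apply (Ck_mono k V W); auto. Qed.

Lemma locally_neq_zero (W : R * R * R -> Prop) (f : R -> R -> R -> R) (t x u : R) :
  smooth W f -> W (t, x, u) -> f t x u <> 0 ->
  locally (t, x, u) (fun q : R * R * R => f (fst (fst q)) (snd (fst q)) (snd q) <> 0).
Proof.
intros hf Hw Hn; exact (smooth_continuous W f t x u hf Hw _ (open_neq 0 _ Hn)).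
Qed.

(** Freezing u commutes with the derivatives in t and x and makes the derivative in u zero, so the
    induction never leaves functions of this shape. *)
Lemma Ck_slice (k : nat) : forall (W : R * R * R -> Prop) (D : R * R -> Prop)
    (f : R -> R -> R -> R) (u0 : R),
  open D -> (forall t x, D (t, x) -> W (t, x, u0)) -> Ck k W f ->
  Ck k (fun p => D (fst p)) (fun t x _ => f t x u0).
Proof.
intros W D f u0 hD HDW.
assert (hD' : open (fun p : R * R * R => D (fst p))).
{ intros [[t x] u] H. destruct (hD _ H) as [e He]; exists e.
  intros q [H1 H2]; apply He, H1. }
assert (Hc : forall g : R -> R -> R -> R,
  (forall t x u, W (t, x, u) -> continuous
    (fun p : R * R * R => g (fst (fst p)) (snd (fst p)) (snd p)) (t, x, u)) ->
  forall t x u, D (t, x) -> continuous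
    (fun p : R * R * R => g (fst (fst p)) (snd (fst p)) u0) (t, x, u)).
{ intros g H t x u Hd.
  apply (continuous_comp (fun p : R * R * R => (fst (fst p), snd (fst p), u0))
           (fun p : R * R * R => g (fst (fst p)) (snd (fst p)) (snd p)) (t, x, u));
    [|apply H, HDW, Hd].
  intros P [e He]; exists e; intros z [[H1 H2] H3]; apply He.
  repeat split; simpl; auto using ball_center. }
revert f; induction k as [|k IH]; intros f.
- intros [H _]; split; [apply Hc; exact H|exact I].
- intros (H & He & Ht & Hx & Hu).
  split; [apply Hc; exact H|].
  split.
  { intros t x u Hd; destruct (He _ _ _ (HDW _ _ Hd)) as (H1 & H2 & H3).
    repeat split; [exact H1|exact H2|apply ex_derive_const]. }
  repeat split; [exact (IH _ Ht)|exact (IH _ Hx)|].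
  apply Ck_ext with (fun _ _ _ => 0); [exact hD'| |apply Ck_const, hD'].
  intros t x u _; exact (eq_sym (Derive_const _ _)).
Qed.

Lemma smooth2_slice (W : R * R * R -> Prop) (D : R * R -> Prop)
    (f : R -> R -> R -> R) (u0 : R) :
  open D -> (forall t x, D (t, x) -> W (t, x, u0)) -> smooth W f ->
  smooth2 D (fun t x => f t x u0).
Proof. intros hD H F k; apply (Ck_slice k W); auto. Qed.

(** * Analytic functions *)

(** Serves to restrict a double power series to a coordinate line through its centre: in each total
    degree a single term survives. *)
Lemma sum_n_single (f : nat -> R) (n k : nat) :
  (k <= n)%nat -> (forall i, (i <= n)%nat -> i <> k -> f i = 0) -> sum_n f n = f k.
Proof.
induction n as [|n IH]; intros Hk Hf.
- replace k with O by lia. apply sum_O.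
- rewrite sum_Sn. destruct (Nat.eq_dec k (S n)) as [->|Hne].
  + rewrite (sum_n_ext_loc f (fun _ => 0)).
    * rewrite sum_n_const, Rmult_0_r; apply Rplus_0_l.
    * intros i Hi; apply Hf; lia.
  + rewrite IH; [|lia|intros; apply Hf; lia].
    rewrite (Hf (S n)) by lia; apply Rplus_0_r.
Qed.

Lemma ex_derive_power_series (f : R -> R) (c : nat -> R) (s0 r : R) :
  0 < r ->
  (forall s, Rabs (s - s0) < r -> is_series (fun n => c n * (s - s0) ^ n) (f s)) ->
  ex_derive f s0.
Proof.
intros Hr Hf.
assert (Hp : forall s, Rabs (s - s0) < r -> is_pseries c (s - s0) (f s)).
{ intros s Hs; generalize (Hf s Hs); apply is_series_ext.
  intros n; rewrite <- pow_n_pow; apply Rmult_comm. }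
(* Convergence at distance r/2 forces the terms to tend to 0 there, so the radius of convergence is
   at least r/2, hence positive. *)
assert (Hrad : Rbar_lt (Rabs 0) (CV_radius c)).
{ assert (H : Rabs (s0 + r / 2 - s0) < r).
  { replace (s0 + r / 2 - s0) with (r / 2) by ring. rewrite Rabs_pos_eq; lra. }
  apply Hf in H.
  apply Rbar_lt_le_trans with (Rabs (s0 + r / 2 - s0)).
  - replace (s0 + r / 2 - s0) with (r / 2) by ring.
    rewrite Rabs_R0, Rabs_pos_eq; simpl; lra.
  - apply Rbar_not_lt_le; intros Hlt; apply (CV_disk_outside _ _ Hlt).
    apply ex_series_lim_0; eexists; exact H. }
apply (ex_derive_ext_loc (fun s => PSeries c (s - s0))).
- exists (mkposreal _ Hr); intros s Hs.
  apply is_pseries_unique, Hp, Hs.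
- apply (ex_derive_comp (PSeries c) (fun s => s - s0)).
  + apply ex_derive_PSeries. rewrite Rminus_diag. exact Hrad.
  + auto_derive; auto.
Qed.

Lemma analytic2_ex_derive (D : R * R -> Prop) (g : R -> R -> R) (t x : R) :
  analytic2 D g -> D (t, x) ->
  ex_derive (fun s => g s x) t /\ ex_derive (fun s => g t s) x.
Proof.
intros hg Hd; destruct (hg _ _ Hd) as (a & r & Hr & _ & Hs); split.
- apply (ex_derive_power_series _ (fun n => a n O) t r Hr).
  intros s Hst. generalize (Hs s x Hst).
  rewrite Rminus_diag, Rabs_R0; intros H; generalize (H Hr); apply is_series_ext.
  (* At x equal to the centre only the term with exponent 0 in x remains, because 0 ^ 0 = 1 and all
     higher powers of 0 vanish. *)
  intros n; rewrite (sum_n_single _ n n); [|lia|].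
  + rewrite Nat.sub_diag; simpl; ring.
  + intros i Hi Hne; rewrite (pow_i (n - i)) by lia; ring.
- apply (ex_derive_power_series _ (fun n => a O n) x r Hr).
  intros s Hst. generalize (Hs t s).
  rewrite Rminus_diag, Rabs_R0; intros H; generalize (H Hr Hst); apply is_series_ext.
  intros n; rewrite (sum_n_single _ n O); [|lia|].
  + rewrite Nat.sub_0_r; simpl; ring.
  + intros i Hi Hne; rewrite (pow_i i) by lia; ring.
Qed.

(** * Total derivatives and the second prolongation *)

(** The iterated total derivative D_x D_x f, written out for a function f of t, x, u. *)
Definition Dxx0 (f : R -> R -> R -> R) (t x u ux uxx : R) : R :=
  pdx (pdx f) t x u + 2 * ux * pdx (pdu f) t x u + ux ^ 2 * pdu (pdu f) t x u
  + uxx * pdu f t x u.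

Ltac pd_derive :=
  apply is_derive_unique; auto_derive; [repeat split; try assumption|].

Lemma pd_mult (W : R * R * R -> Prop) (f g : R -> R -> R -> R) (t x u : R) :
  smooth W f -> smooth W g -> W (t, x, u) ->
  pdt (fun t x u => f t x u * g t x u) t x u
    = pdt f t x u * g t x u + f t x u * pdt g t x u /\
  pdx (fun t x u => f t x u * g t x u) t x u
    = pdx f t x u * g t x u + f t x u * pdx g t x u /\
  pdu (fun t x u => f t x u * g t x u) t x u
    = pdu f t x u * g t x u + f t x u * pdu g t x u.
Proof.
intros hf hg Hw.
destruct (smooth_ex_derive _ _ _ _ _ hf Hw) as (?&?&?),
         (smooth_ex_derive _ _ _ _ _ hg Hw) as (?&?&?).
repeat split; apply Derive_mult; assumption.
Qed.

Section Product_rules.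
Variable W : R * R * R -> Prop.
Hypothesis hW : open W.
Variables f g h : R -> R -> R -> R.
Hypothesis hf : smooth W f.
Hypothesis hg : smooth W g.
Hypothesis hh : forall t x u, W (t, x, u) -> h t x u = f t x u * g t x u.

(** The factorization of [h] is assumed only on [W], which is what [equivalent_on] provides for the
    coefficients of two equivalent operators. *)
Lemma pd_eq_mult (t x u : R) : W (t, x, u) ->
  pdt h t x u = pdt f t x u * g t x u + f t x u * pdt g t x u /\
  pdx h t x u = pdx f t x u * g t x u + f t x u * pdx g t x u /\
  pdu h t x u = pdu f t x u * g t x u + f t x u * pdu g t x u.
Proof.
intros Hw.
destruct (pd_ext_open W hW _ _ t x u hh Hw) as (->&->&->).
apply pd_mult with W; assumption.
Qed.

Lemma Dt0_eq_mult (t x u ut ux : R) : W (t, x, u) ->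
  Dt0 h t x u ut ux = Dt0 f t x u ut ux * g t x u + f t x u * Dt0 g t x u ut ux.
Proof.
intros Hw; unfold Dt0; destruct (pd_eq_mult t x u Hw) as (->&_&->); ring.
Qed.

Lemma Dx0_eq_mult (t x u ut ux : R) : W (t, x, u) ->
  Dx0 h t x u ut ux = Dx0 f t x u ut ux * g t x u + f t x u * Dx0 g t x u ut ux.
Proof.
intros Hw; unfold Dx0; destruct (pd_eq_mult t x u Hw) as (_&->&->); ring.
Qed.

Lemma Dxx0_eq_mult (t x u ut ux uxx : R) : W (t, x, u) ->
  Dxx0 h t x u ux uxx = Dxx0 f t x u ux uxx * g t x u
    + 2 * Dx0 f t x u ut ux * Dx0 g t x u ut ux + f t x u * Dxx0 g t x u ux uxx.
Proof.
intros Hw.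
assert (Hx : forall t x u, W (t, x, u) ->
  pdx h t x u = pdx f t x u * g t x u + f t x u * pdx g t x u).
{ intros; apply pd_eq_mult; assumption. }
assert (Hu : forall t x u, W (t, x, u) ->
  pdu h t x u = pdu f t x u * g t x u + f t x u * pdu g t x u).
{ intros; apply pd_eq_mult; assumption. }
unfold Dxx0.
destruct (pd_ext_open W hW _ _ t x u Hx Hw) as (_&->&_).
destruct (pd_ext_open W hW _ _ t x u Hu Hw) as (_&->&->).
destruct (pd_eq_mult t x u Hw) as (_&_&->).
destruct (smooth_ex_derive _ _ _ _ _ hf Hw) as (_&?&?),
         (smooth_ex_derive _ _ _ _ _ hg Hw) as (_&?&?),
         (smooth_ex_derive _ _ _ _ _ (smooth_pdx _ _ hf) Hw) as (_&?&?),
         (smooth_ex_derive _ _ _ _ _ (smooth_pdx _ _ hg) Hw) as (_&?&?),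
         (smooth_ex_derive _ _ _ _ _ (smooth_pdu _ _ hf) Hw) as (_&?&?),
         (smooth_ex_derive _ _ _ _ _ (smooth_pdu _ _ hg) Hw) as (_&?&?).
assert (E1 : pdx (fun t x u => pdx f t x u * g t x u + f t x u * pdx g t x u) t x u
  = pdx (pdx f) t x u * g t x u + 2 * pdx f t x u * pdx g t x u
    + f t x u * pdx (pdx g) t x u).
{ unfold pdx at 1; pd_derive. unfold pdx, pdu; ring. }
assert (E2 : pdx (fun t x u => pdu f t x u * g t x u + f t x u * pdu g t x u) t x u
  = pdx (pdu f) t x u * g t x u + pdu f t x u * pdx g t x u
    + pdx f t x u * pdu g t x u + f t x u * pdx (pdu g) t x u).
{ unfold pdx at 1; pd_derive. unfold pdx, pdu; ring. }
assert (E3 : pdu (fun t x u => pdu f t x u * g t x u + f t x u * pdu g t x u) t x u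
  = pdu (pdu f) t x u * g t x u + 2 * pdu f t x u * pdu g t x u
    + f t x u * pdu (pdu g) t x u).
{ unfold pdu at 1; pd_derive. unfold pdx, pdu; ring. }
rewrite E1, E2, E3; unfold Dx0; ring.
Qed.

End Product_rules.

Section Prolongation.
Variables (A B C : R -> R -> R) (W : R * R * R -> Prop) (Q : operator).
Hypothesis hW : open W.
Hypothesis htau : smooth W (tau Q).
Hypothesis hxi : smooth W (xi Q).
Hypothesis heta : smooth W (eta Q).

(** The first prolongation coefficient is D_t Q[u] + tau u_tt + xi u_tx. Thus the differential
    consequence D_t Q[u] = 0 becomes a relation linear in u_tt and u_tx. *)
Lemma Dt1_characteristic (t x u ut ux utt utx uxx : R) : W (t, x, u) ->
  Dt1 (characteristic Q) t x u ut ux utt utx uxx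
  = eta_t Q t x u ut ux - tau Q t x u * utt - xi Q t x u * utx.
Proof.
intros Hw; unfold Dt1, characteristic, eta_t, Dt0.
destruct (smooth_ex_derive _ _ _ _ _ htau Hw) as (?&?&?),
         (smooth_ex_derive _ _ _ _ _ hxi Hw) as (?&?&?),
         (smooth_ex_derive _ _ _ _ _ heta Hw) as (?&?&?).
erewrite (is_derive_unique _ t) by (auto_derive; [repeat split; assumption|reflexivity]).
erewrite (is_derive_unique _ u) by (auto_derive; [repeat split; assumption|reflexivity]).
erewrite (is_derive_unique _ ut) by (auto_derive; [repeat split; assumption|reflexivity]).
erewrite (is_derive_unique _ ux) by (auto_derive; [repeat split; assumption|reflexivity]).
unfold pdt, pdu; ring.
Qed.

Lemma Dx1_characteristic (t x u ut ux utt utx uxx : R) : W (t, x, u) ->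
  Dx1 (characteristic Q) t x u ut ux utt utx uxx
  = eta_x Q t x u ut ux - tau Q t x u * utx - xi Q t x u * uxx.
Proof.
intros Hw; unfold Dx1, characteristic, eta_x, Dx0.
destruct (smooth_ex_derive _ _ _ _ _ htau Hw) as (?&?&?),
         (smooth_ex_derive _ _ _ _ _ hxi Hw) as (?&?&?),
         (smooth_ex_derive _ _ _ _ _ heta Hw) as (?&?&?).
erewrite (is_derive_unique _ x) by (auto_derive; [repeat split; assumption|reflexivity]).
erewrite (is_derive_unique _ u) by (auto_derive; [repeat split; assumption|reflexivity]).
erewrite (is_derive_unique _ ut) by (auto_derive; [repeat split; assumption|reflexivity]).
erewrite (is_derive_unique _ ux) by (auto_derive; [repeat split; assumption|reflexivity]).
unfold pdx, pdu; ring.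
Qed.

Lemma eta_xx_expand (t x u ut ux utt utx uxx : R) : W (t, x, u) ->
  eta_xx Q t x u ut ux utt utx uxx
  = Dxx0 (eta Q) t x u ux uxx - ut * Dxx0 (tau Q) t x u ux uxx
    - ux * Dxx0 (xi Q) t x u ux uxx
    - 2 * utx * Dx0 (tau Q) t x u ut ux - 2 * uxx * Dx0 (xi Q) t x u ut ux.
Proof.
intros Hw; unfold eta_xx, Dx1, eta_x, Dx0, Dxx0.
destruct (smooth_ex_derive _ _ _ _ _ (smooth_pdx _ _ htau) Hw) as (_&?&?),
         (smooth_ex_derive _ _ _ _ _ (smooth_pdx _ _ hxi) Hw) as (_&?&?),
         (smooth_ex_derive _ _ _ _ _ (smooth_pdx _ _ heta) Hw) as (_&?&?),
         (smooth_ex_derive _ _ _ _ _ (smooth_pdu _ _ htau) Hw) as (_&?&?),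
         (smooth_ex_derive _ _ _ _ _ (smooth_pdu _ _ hxi) Hw) as (_&?&?),
         (smooth_ex_derive _ _ _ _ _ (smooth_pdu _ _ heta) Hw) as (_&?&?).
erewrite (is_derive_unique _ x) by (auto_derive; [repeat split; assumption|reflexivity]).
erewrite (is_derive_unique _ u) by (auto_derive; [repeat split; assumption|reflexivity]).
erewrite (is_derive_unique _ ut) by (auto_derive; [repeat split; assumption|reflexivity]).
erewrite (is_derive_unique _ ux) by (auto_derive; [repeat split; assumption|reflexivity]).
(* D_x of [eta_x] produces the mixed derivative in both orders; they must agree to merge into the
   term 2 u_x f_xu of [Dxx0]. *)
assert (E1 := pdu_pdx_comm W hW _ _ _ _ htau Hw).
assert (E2 := pdu_pdx_comm W hW _ _ _ _ hxi Hw).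
assert (E3 := pdu_pdx_comm W hW _ _ _ _ heta Hw).
fold (pdu (pdx (tau Q)) t x u) (pdu (pdx (xi Q)) t x u) (pdu (pdx (eta Q)) t x u).
rewrite E1, E2, E3.
fold (pdx (pdx (tau Q)) t x u) (pdx (pdx (xi Q)) t x u) (pdx (pdx (eta Q)) t x u).
fold (pdx (pdu (tau Q)) t x u) (pdx (pdu (xi Q)) t x u) (pdx (pdu (eta Q)) t x u).
fold (pdu (pdu (tau Q)) t x u) (pdu (pdu (xi Q)) t x u) (pdu (pdu (eta Q)) t x u).
ring.
Qed.

Lemma prolongation2_Lop (t x u ut ux utt utx uxx : R) :
  (ex_derive (fun s => A s x) t /\ ex_derive (fun s => A t s) x) ->
  (ex_derive (fun s => B s x) t /\ ex_derive (fun s => B t s) x) ->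
  (ex_derive (fun s => C s x) t /\ ex_derive (fun s => C t s) x) ->
  prolongation2 Q (Lop A B C) t x u ut ux utt utx uxx
  = eta_t Q t x u ut ux - A t x * eta_xx Q t x u ut ux utt utx uxx
    - B t x * eta_x Q t x u ut ux - C t x * eta Q t x u
    - tau Q t x u * (pdt2 A t x * uxx + pdt2 B t x * ux + pdt2 C t x * u)
    - xi Q t x u * (pdx2 A t x * uxx + pdx2 B t x * ux + pdx2 C t x * u).
Proof.
intros [? ?] [? ?] [? ?]; unfold prolongation2, Lop.
erewrite (is_derive_unique _ t) by (auto_derive; [repeat split; assumption|reflexivity]).
erewrite (is_derive_unique _ x) by (auto_derive; [repeat split; assumption|reflexivity]).
erewrite (is_derive_unique _ u) by (auto_derive; [repeat split; assumption|reflexivity]).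
erewrite (is_derive_unique _ ut) by (auto_derive; [repeat split; assumption|reflexivity]).
erewrite (is_derive_unique _ ux) by (auto_derive; [repeat split; assumption|reflexivity]).
erewrite (is_derive_unique _ uxx) by (auto_derive; [repeat split; assumption|reflexivity]).
(* L contains neither u_tt nor u_tx, so the terms with [eta_tt] and [eta_tx] disappear here. *)
rewrite !Derive_const; unfold pdt2, pdx2; ring.
Qed.

End Prolongation.

(** * Reduced forms of the criterion *)

Definition partially_differentiable (V : R * R * R -> Prop) (g : R -> R -> R) : Prop :=
  forall t x u, V (t, x, u) ->
    ex_derive (fun s => g s x) t /\ ex_derive (fun s => g t s) x.

Definition smooth_operator (V : R * R * R -> Prop) (Q : operator) : Prop :=
  smooth V (tau Q) /\ smooth V (xi Q) /\ smooth V (eta Q).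

(** The last clause of [reduction_operator]. It is separated because it passes to subsets of [W],
    unlike the existence of a point with (tau, xi) nonzero. *)
Definition invariance_criterion (A B C : R -> R -> R) (W : R * R * R -> Prop)
    (Q : operator) : Prop :=
  forall t x u ut ux utt utx uxx : R,
    W (t, x, u) ->
    Lop A B C t x u ut ux utt utx uxx = 0 ->
    characteristic Q t x u ut ux = 0 ->
    Dt1 (characteristic Q) t x u ut ux utt utx uxx = 0 ->
    Dx1 (characteristic Q) t x u ut ux utt utx uxx = 0 ->
    prolongation2 Q (Lop A B C) t x u ut ux utt utx uxx = 0.

(* Replacing Q by lambda Q adds to every prolongation coefficient only terms
   containing Q[u], D_t Q[u] or D_x Q[u]. *)
Lemma invariance_criterion_equivalent (A B C : R -> R -> R)
    (W : R * R * R -> Prop) (Q Q' : operator) :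
  open W ->
  partially_differentiable W A -> partially_differentiable W B ->
  partially_differentiable W C ->
  smooth_operator W Q -> smooth_operator W Q' -> equivalent_on W Q Q' ->
  invariance_criterion A B C W Q -> invariance_criterion A B C W Q'.
Proof.
intros hW hA hB hC (ht & hx & he) (ht' & hx' & he') (l & hl & Hl) HQ
  t x u ut ux utt utx uxx Hw HL H0 Ht Hx.
assert (Et : forall t x u, W (t, x, u) -> tau Q' t x u = l t x u * tau Q t x u)
  by (intros; apply Hl; assumption).
assert (Ex : forall t x u, W (t, x, u) -> xi Q' t x u = l t x u * xi Q t x u)
  by (intros; apply Hl; assumption).
assert (Ee : forall t x u, W (t, x, u) -> eta Q' t x u = l t x u * eta Q t x u)
  by (intros; apply Hl; assumption).
destruct (Hl t x u Hw) as [Hl0 _].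
specialize (HQ t x u ut ux utt utx uxx Hw HL).
(* The constraints for Q are recovered from those for Q': modulo Q[u] = 0 each constraint for Q' is
   lambda times the one for Q, and lambda cancels. *)
assert (C0 : characteristic Q t x u ut ux = 0).
{ apply Rmult_eq_reg_l with (l t x u); [|exact Hl0].
  rewrite Rmult_0_r, <- H0; unfold characteristic.
  rewrite (Et _ _ _ Hw), (Ex _ _ _ Hw), (Ee _ _ _ Hw); ring. }
assert (F1 : eta_t Q' t x u ut ux = l t x u * eta_t Q t x u ut ux
  + Dt0 l t x u ut ux * characteristic Q t x u ut ux).
{ unfold eta_t, characteristic.
  rewrite (Dt0_eq_mult W hW l (tau Q) (tau Q')), (Dt0_eq_mult W hW l (xi Q) (xi Q')),
    (Dt0_eq_mult W hW l (eta Q) (eta Q')) by assumption; ring. }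
assert (F2 : eta_x Q' t x u ut ux = l t x u * eta_x Q t x u ut ux
  + Dx0 l t x u ut ux * characteristic Q t x u ut ux).
{ unfold eta_x, characteristic.
  rewrite (Dx0_eq_mult W hW l (tau Q) (tau Q')), (Dx0_eq_mult W hW l (xi Q) (xi Q')),
    (Dx0_eq_mult W hW l (eta Q) (eta Q')) by assumption; ring. }
rewrite (Dt1_characteristic W) in Ht, HQ by assumption.
rewrite (Dx1_characteristic W) in Hx, HQ by assumption.
rewrite (prolongation2_Lop A B C) in HQ |- * by eauto.
rewrite F1, C0, (Et _ _ _ Hw), (Ex _ _ _ Hw) in Ht.
rewrite F2, C0, (Et _ _ _ Hw), (Ex _ _ _ Hw) in Hx.
assert (Ct : eta_t Q t x u ut ux - tau Q t x u * utt - xi Q t x u * utx = 0).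
{ apply Rmult_eq_reg_l with (l t x u); [|exact Hl0]. lra. }
assert (Cx : eta_x Q t x u ut ux - tau Q t x u * utx - xi Q t x u * uxx = 0).
{ apply Rmult_eq_reg_l with (l t x u); [|exact Hl0]. lra. }
specialize (HQ C0 Ct Cx).
assert (F3 : eta_xx Q' t x u ut ux utt utx uxx
  = l t x u * eta_xx Q t x u ut ux utt utx uxx
    + 2 * Dx0 l t x u ut ux
      * (eta_x Q t x u ut ux - tau Q t x u * utx - xi Q t x u * uxx)
    + Dxx0 l t x u ux uxx * characteristic Q t x u ut ux).
{ rewrite !(eta_xx_expand W) by assumption.
  rewrite (Dx0_eq_mult W hW l (tau Q) (tau Q')), (Dx0_eq_mult W hW l (xi Q) (xi Q')),
    (Dxx0_eq_mult W hW l (tau Q) (tau Q')) with (ut := ut),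
    (Dxx0_eq_mult W hW l (xi Q) (xi Q')) with (ut := ut),
    (Dxx0_eq_mult W hW l (eta Q) (eta Q')) with (ut := ut) by assumption.
  unfold eta_x, characteristic; ring. }
rewrite F1, F2, F3, C0, Cx, (Et _ _ _ Hw), (Ex _ _ _ Hw), (Ee _ _ _ Hw).
(* With Q[u] and D_x Q[u] removed, the criterion for Q' is lambda times the criterion for Q. *)
apply (f_equal (Rmult (l t x u))) in HQ; rewrite Rmult_0_r in HQ.
etransitivity; [|exact HQ]; ring.
Qed.

Lemma pdt_const (c : R) : pdt (fun _ _ _ => c) = fun _ _ _ => 0.
Proof.
repeat (apply functional_extensionality; intros ?); exact (Derive_const c _).
Qed.

Lemma pdx_const (c : R) : pdx (fun _ _ _ => c) = fun _ _ _ => 0.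
Proof.
repeat (apply functional_extensionality; intros ?); exact (Derive_const c _).
Qed.

Lemma pdu_const (c : R) : pdu (fun _ _ _ => c) = fun _ _ _ => 0.
Proof.
repeat (apply functional_extensionality; intros ?); exact (Derive_const c _).
Qed.

Lemma criterion_tau0 (A B C : R -> R -> R) (W : R * R * R -> Prop)
    (h : R -> R -> R -> R) :
  open W ->
  partially_differentiable W A -> partially_differentiable W B ->
  partially_differentiable W C -> smooth W h ->
  invariance_criterion A B C W (Operator (fun _ _ _ => 0) (fun _ _ _ => 1) h) ->
  forall t x u, W (t, x, u) -> eta_equation A B C h t x u.
Proof.
intros hW hA hB hC hh HQ t x u Hw.
(* The constraints fix the jet over (t, x, u): Q[u] = 0 gives u_x, D_x Q[u] = 0 gives u_xx, Lu = 0
   gives u_t and D_t Q[u] = 0 gives u_tx; u_tt is set to 0. *)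
set (ux := h t x u).
set (uxx := pdx h t x u + ux * pdu h t x u).
set (ut := A t x * uxx + B t x * ux + C t x * u).
specialize (HQ t x u ut ux 0 (pdt h t x u + ut * pdu h t x u) uxx Hw).
rewrite (Dt1_characteristic W), (Dx1_characteristic W), (prolongation2_Lop A B C),
  (eta_xx_expand W) in HQ by (simpl; eauto using smooth_const).
unfold eta_equation.
replace (pdx (fun t x u => B t x * h t x u) t x u)
  with (pdx2 B t x * h t x u + B t x * pdx h t x u).
2: { symmetry; apply Derive_mult; [apply (hB _ _ _ Hw)|].
     apply (smooth_ex_derive W h _ _ _ hh Hw). }
rewrite (pdu_pdx_comm W) by assumption.
unfold characteristic, eta_t, eta_x, Dt0, Dx0, Dxx0, Lop in HQ; simpl in HQ.
rewrite ?pdt_const, ?pdx_const, ?pdu_const, ?pdx_const, ?pdu_const in HQ.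
lapply HQ; [clear HQ; intros HQ|unfold ut; ring].
lapply HQ; [clear HQ; intros HQ|unfold ux; ring].
lapply HQ; [clear HQ; intros HQ|ring].
lapply HQ; [clear HQ; intros HQ|unfold uxx; ring].
apply Rminus_diag_uniq; rewrite <- HQ.
unfold ut, uxx, ux; ring.
Qed.

Lemma cubic_coefficients_zero (c0 c1 c2 c3 : R) :
  (forall p, c3 * p ^ 3 + c2 * p ^ 2 + c1 * p + c0 = 0) ->
  c3 = 0 /\ c2 = 0 /\ c1 = 0 /\ c0 = 0.
Proof.
intros H.
(* A cubic is determined by its values at four distinct points, so these four linear equations force
   all coefficients to be zero. *)
assert (H0 := H 0); assert (H1 := H 1); assert (H2 := H (-1)); assert (H3 := H 2).
repeat split; lra.
Qed.

(* Up to the factor A of g_uu, the left-hand sides are the coefficients of u_x^3,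
   u_x^2, u_x and 1 after elimination of u_t, u_tx and u_xx. *)
Lemma criterion_tau1 (A B C : R -> R -> R) (W : R * R * R -> Prop)
    (g h : R -> R -> R -> R) :
  open W ->
  partially_differentiable W A -> partially_differentiable W B ->
  partially_differentiable W C -> smooth W g -> smooth W h ->
  (forall t x u, W (t, x, u) -> A t x <> 0) ->
  invariance_criterion A B C W (Operator (fun _ _ _ => 1) g h) ->
  forall t x u, W (t, x, u) ->
  pdu (pdu g) t x u = 0 /\
  - A t x * pdu (pdu h) t x u + 2 * A t x * pdx (pdu g) t x u
    - 2 * pdu g t x u * (g t x u + B t x) = 0 /\
  - pdt g t x u - h t x u * pdu g t x u - 2 * A t x * pdx (pdu h) t x u
    + A t x * pdx (pdx g) t x u + 3 * pdu g t x u * (h t x u - C t x * u)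
    - 2 * pdx g t x u * (g t x u + B t x) + B t x * pdx g t x u
    + (pdt2 A t x / A t x + g t x u * (pdx2 A t x / A t x)) * (g t x u + B t x)
    - pdt2 B t x - g t x u * pdx2 B t x = 0 /\
  pdt h t x u - A t x * pdx (pdx h) t x u - B t x * pdx h t x u
    + C t x * u * pdu h t x u - C t x * h t x u
    + (2 * pdx g t x u - pdt2 A t x / A t x - g t x u * (pdx2 A t x / A t x))
      * (h t x u - C t x * u)
    - pdt2 C t x * u - g t x u * pdx2 C t x * u = 0.
Proof.
intros hW hA hB hC hg hh hA0 HQ t x u Hw.
assert (A0 := hA0 _ _ _ Hw).
assert (Hc := cubic_coefficients_zero).
(* The polynomial variable is u_x. The lower coefficients are taken from the goal, and the leading
   one is A g_uu, from which A is then cancelled. *)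
match goal with |- _ /\ ?c2 = 0 /\ ?c1 = 0 /\ ?c0 = 0 =>
  specialize (Hc c0 c1 c2 (A t x * pdu (pdu g) t x u)) end.
destruct Hc as (H3 & Hc); cycle 1.
{ split; [|exact Hc]. apply Rmult_integral in H3; destruct H3; [contradiction|assumption]. }
intros ux.
(* For an arbitrary u_x the rest of the jet is solved for: u_t from Q[u] = 0, u_xx from Lu = 0 by
   dividing by A, u_tx from D_x Q[u] = 0, and u_tt from D_t Q[u] = 0. *)
set (ut := h t x u - g t x u * ux).
set (uxx := (ut - B t x * ux - C t x * u) / A t x).
set (utx := pdx h t x u + ux * pdu h t x u
  - ux * (pdx g t x u + ux * pdu g t x u) - g t x u * uxx).
specialize (HQ t x u ut ux
  (pdt h t x u + ut * pdu h t x u - ux * (pdt g t x u + ut * pdu g t x u)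
   - g t x u * utx) utx uxx Hw).
rewrite (Dt1_characteristic W), (Dx1_characteristic W), (prolongation2_Lop A B C),
  (eta_xx_expand W) in HQ by (simpl; eauto using smooth_const).
unfold characteristic, eta_t, eta_x, Dt0, Dx0, Dxx0, Lop in HQ; simpl in HQ.
rewrite ?pdt_const, ?pdx_const, ?pdu_const, ?pdx_const, ?pdu_const in HQ.
lapply HQ; [clear HQ; intros HQ|unfold uxx; field; exact A0].
lapply HQ; [clear HQ; intros HQ|unfold ut; ring].
lapply HQ; [clear HQ; intros HQ|ring].
lapply HQ; [clear HQ; intros HQ|unfold utx; ring].
rewrite <- HQ; clear HQ.
unfold utx, uxx, ut; field; exact A0.
Qed.

Section Open_domain_zero.
Variable W : R * R * R -> Prop.
Hypothesis hW : open W.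

(** Differentiates an identity in u. With [is_derive] in the hypothesis, the equation to be proved
    supplies [l], and [auto_derive] reduces the claim to an algebraic comparison. *)
Lemma derive_u_zero (f : R -> R -> R -> R) (t x u l : R) :
  (forall t x u, W (t, x, u) -> f t x u = 0) -> W (t, x, u) ->
  is_derive (fun s => f t x s) u l -> l = 0.
Proof.
intros H Hw Hl; rewrite <- (is_derive_unique _ _ _ Hl).
destruct (pd_ext_open W hW f (fun _ _ _ => 0) t x u H Hw) as (_&_&E).
exact (eq_trans E (Derive_const 0 u)).
Qed.

Lemma pd_zero (f : R -> R -> R -> R) (t x u : R) :
  (forall t x u, W (t, x, u) -> f t x u = 0) -> W (t, x, u) ->
  pdt f t x u = 0 /\ pdx f t x u = 0 /\ pdu f t x u = 0.
Proof.
intros H Hw.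
destruct (pd_ext_open W hW f (fun _ _ _ => 0) t x u H Hw) as (->&->&->).
rewrite pdt_const, pdx_const, pdu_const; auto.
Qed.

End Open_domain_zero.

(* The second equation makes h a cubic polynomial in u with leading coefficient
   -(g_u)^2/(3A), so the coefficient of u^3 in the third one is a multiple of
   (g_u)^3; it is extracted by differentiating three times in u. *)
Lemma pdu_g_zero (A B C : R -> R -> R) (W : R * R * R -> Prop)
    (g h : R -> R -> R -> R) :
  open W -> smooth W g -> smooth W h ->
  (forall t x u, W (t, x, u) -> A t x <> 0) ->
  (forall t x u, W (t, x, u) -> pdu (pdu g) t x u = 0) ->
  (forall t x u, W (t, x, u) ->
    - A t x * pdu (pdu h) t x u + 2 * A t x * pdx (pdu g) t x u
    - 2 * pdu g t x u * (g t x u + B t x) = 0) ->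
  (forall t x u, W (t, x, u) ->
    - pdt g t x u - h t x u * pdu g t x u - 2 * A t x * pdx (pdu h) t x u
    + A t x * pdx (pdx g) t x u + 3 * pdu g t x u * (h t x u - C t x * u)
    - 2 * pdx g t x u * (g t x u + B t x) + B t x * pdx g t x u
    + (pdt2 A t x / A t x + g t x u * (pdx2 A t x / A t x)) * (g t x u + B t x)
    - pdt2 B t x - g t x u * pdx2 B t x = 0) ->
  forall t x u, W (t, x, u) -> pdu g t x u = 0.
Proof.
intros hW hg hh hA0 E3 E2 E1.
assert (sg1 := smooth_pdu _ _ hg).
assert (sgx := smooth_pdx _ _ hg).
assert (sgt := smooth_pdt _ _ hg).
assert (sgxx := smooth_pdx _ _ sgx).
assert (sg1x := smooth_pdx _ _ sg1).
assert (sg1t := smooth_pdt _ _ sg1).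
assert (sg1xx := smooth_pdx _ _ sg1x).
assert (sh1 := smooth_pdu _ _ hh).
assert (sh2 := smooth_pdu _ _ sh1).
assert (sh3 := smooth_pdu _ _ sh2).
assert (sk0 := smooth_pdx _ _ sh1).
assert (sk1 := smooth_pdx _ _ sh2).
assert (sk2 := smooth_pdx _ _ sh3).
(* These rules are phrased with [Derive] in the shape that [auto_derive] leaves behind. They record
   that all u-derivatives of g_u and of its derivatives in t and x vanish. *)
assert (G2 : forall t x u, W (t, x, u) -> Derive (fun s => pdu g t x s) u = 0)
  by exact E3.
assert (Gx : forall t x u, W (t, x, u) ->
  Derive (fun s => pdx g t x s) u = pdx (pdu g) t x u)
  by (intros; apply (pdu_pdx_comm W); assumption).
assert (Gt : forall t x u, W (t, x, u) ->
  Derive (fun s => pdt g t x s) u = pdt (pdu g) t x u)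
  by (intros; apply (pdu_pdt_comm W); assumption).
assert (Gxx : forall t x u, W (t, x, u) ->
  Derive (fun s => pdx (pdx g) t x s) u = pdx (pdx (pdu g)) t x u).
{ intros t x u Hw; etransitivity; [apply (pdu_pdx_comm W hW _ _ _ _ sgx Hw)|].
  apply (pd_ext_open W hW); [exact Gx|exact Hw]. }
assert (G1x : forall t x u, W (t, x, u) -> Derive (fun s => pdx (pdu g) t x s) u = 0).
{ intros t x u Hw; etransitivity; [apply (pdu_pdx_comm W hW _ _ _ _ sg1 Hw)|].
  apply (pd_zero W hW); [exact E3|exact Hw]. }
assert (G1t : forall t x u, W (t, x, u) -> Derive (fun s => pdt (pdu g) t x s) u = 0).
{ intros t x u Hw; etransitivity; [apply (pdu_pdt_comm W hW _ _ _ _ sg1 Hw)|].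
  apply (pd_zero W hW); [exact E3|exact Hw]. }
assert (G1xx : forall t x u, W (t, x, u) ->
  Derive (fun s => pdx (pdx (pdu g)) t x s) u = 0).
{ intros t x u Hw; etransitivity; [apply (pdu_pdx_comm W hW _ _ _ _ sg1x Hw)|].
  apply (pd_zero W hW); [exact G1x|exact Hw]. }
assert (K0 : forall t x u, W (t, x, u) ->
  Derive (fun s => pdx (pdu h) t x s) u = pdx (pdu (pdu h)) t x u)
  by (intros; apply (pdu_pdx_comm W); assumption).
assert (K1 : forall t x u, W (t, x, u) ->
  Derive (fun s => pdx (pdu (pdu h)) t x s) u = pdx (pdu (pdu (pdu h))) t x u)
  by (intros; apply (pdu_pdx_comm W); assumption).
assert (ex_u : forall f t x u, smooth W f -> W (t, x, u) ->
  ex_derive (fun s => f t x s) u)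
  by (intros; apply (smooth_ex_derive W); assumption).
(* One u-derivative of [E2], with g_uu = 0: A h_uuu = -2 g_u^2. A further one gives h_uuuu = 0. *)
assert (H3 : forall t x u, W (t, x, u) ->
  - A t x * pdu (pdu (pdu h)) t x u - 2 * (pdu g t x u) ^ 2 = 0).
{ intros t x u Hw; apply (derive_u_zero W hW _ t x u _ E2 Hw).
  auto_derive; [repeat split; apply ex_u; assumption|].
  rewrite G2, G1x by exact Hw.
  unfold pdu; ring. }
assert (H4 : forall t x u, W (t, x, u) -> pdu (pdu (pdu (pdu h))) t x u = 0).
{ intros t x u Hw; assert (A0 := hA0 _ _ _ Hw).
  assert (H : - A t x * pdu (pdu (pdu (pdu h))) t x u = 0).
  { apply (derive_u_zero W hW _ t x u _ H3 Hw).
    auto_derive; [repeat split; apply ex_u; assumption|].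
    rewrite G2 by exact Hw.
    unfold pdu; ring. }
  apply Rmult_integral in H; destruct H; [lra|assumption]. }
assert (K2 : forall t x u, W (t, x, u) ->
  Derive (fun s => pdx (pdu (pdu (pdu h))) t x s) u = 0).
{ intros t x u Hw; etransitivity; [apply (pdu_pdx_comm W hW _ _ _ _ sh3 Hw)|].
  apply (pd_zero W hW); [exact H4|exact Hw]. }
(* [D1], [D2] and [D3] are the successive u-derivatives of [E1]; after the third only the product
   h_uuu g_u is left. *)
assert (D1 : forall t x u, W (t, x, u) ->
  - pdt (pdu g) t x u + 2 * pdu h t x u * pdu g t x u - 3 * pdu g t x u * C t x
  - 2 * A t x * pdx (pdu (pdu h)) t x u + A t x * pdx (pdx (pdu g)) t x u
  - 2 * pdx (pdu g) t x u * (g t x u + B t x) - 2 * pdx g t x u * pdu g t x u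
  + B t x * pdx (pdu g) t x u
  + pdu g t x u * (pdx2 A t x / A t x) * (g t x u + B t x)
  + (pdt2 A t x / A t x + g t x u * (pdx2 A t x / A t x)) * pdu g t x u
  - pdu g t x u * pdx2 B t x = 0).
{ intros t x u Hw; apply (derive_u_zero W hW _ t x u _ E1 Hw).
  auto_derive; [repeat split; apply ex_u; assumption|].
  rewrite G2, Gx, Gt, Gxx, K0 by exact Hw.
  unfold Rdiv; fold (pdu g t x u) (pdu h t x u); ring. }
assert (D2 : forall t x u, W (t, x, u) ->
  2 * pdu (pdu h) t x u * pdu g t x u
  - 2 * A t x * pdx (pdu (pdu (pdu h))) t x u
  - 4 * pdx (pdu g) t x u * pdu g t x u
  + 2 * (pdx2 A t x / A t x) * (pdu g t x u) ^ 2 = 0).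
{ intros t x u Hw; apply (derive_u_zero W hW _ t x u _ D1 Hw).
  auto_derive; [repeat split; apply ex_u; assumption|].
  rewrite G2, Gx, G1x, G1t, G1xx, K1 by exact Hw.
  unfold Rdiv; fold (pdu g t x u) (pdu h t x u) (pdu (pdu h) t x u); ring. }
assert (D3 : forall t x u, W (t, x, u) ->
  2 * pdu (pdu (pdu h)) t x u * pdu g t x u = 0).
{ intros t x u Hw; apply (derive_u_zero W hW _ t x u _ D2 Hw).
  auto_derive; [repeat split; apply ex_u; assumption|].
  rewrite G2, G1x, K2 by exact Hw.
  unfold Rdiv; fold (pdu (pdu h) t x u) (pdu (pdu (pdu h)) t x u); ring. }
intros t x u Hw.
assert (H : (pdu g t x u) ^ 3 = 0).
(* The combination of [H3] and [D3] in which the terms A h_uuu g_u cancel. *)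
{ replace ((pdu g t x u) ^ 3)
    with (- (pdu g t x u) / 2
          * (- A t x * pdu (pdu (pdu h)) t x u - 2 * (pdu g t x u) ^ 2)
          - A t x / 4 * (2 * pdu (pdu (pdu h)) t x u * pdu g t x u)) by field.
  rewrite H3, D3 by exact Hw; ring. }
destruct (Req_dec (pdu g t x u) 0) as [Z|Z]; [exact Z|].
destruct (pow_nonzero _ 3 Z H).
Qed.

(** * Normal form on a ball for tau = 1 *)

(** The ball is a cube, so the segment in the u-direction from (t, x, u) to the central slice stays
    inside, and the mean value theorem applies along it. *)
Lemma constant_in_u (p : R * R * R) (r : R) (f : R -> R -> R -> R) :
  smooth (ball p r) f ->
  (forall t x u, ball p r (t, x, u) -> pdu f t x u = 0) ->
  forall t x u, ball p r (t, x, u) -> f t x u = f t x (snd p).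
Proof.
intros hf Hf t x u [H12 H3]; simpl in H12, H3.
assert (Hc : forall c, Rmin (snd p) u <= c <= Rmax (snd p) u -> ball p r (t, x, c)).
{ intros c Hc; split; [exact H12|]; simpl.
  apply Rabs_def2 in H3. unfold minus, plus, opp in H3; simpl in H3.
  apply Rabs_def1; unfold minus, plus, opp; simpl;
    revert Hc; unfold Rmin, Rmax; destruct Rle_dec; lra. }
assert (He : forall c, Rmin (snd p) u <= c <= Rmax (snd p) u ->
  is_derive (fun s => f t x s) c 0).
{ intros c Hc'; rewrite <- (Hf _ _ _ (Hc c Hc')); apply Derive_correct.
  apply (smooth_ex_derive _ _ _ _ _ hf (Hc c Hc')). }
destruct (MVT_gen (fun s => f t x s) (snd p) u (fun _ => 0)) as (c & _ & E).
- intros c Hc'; apply He; lra.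
- intros c Hc'; apply continuity_pt_filterlim.
  apply (ex_derive_continuous (V := R_NormedModule)); eexists; apply He, Hc'.
- lra.
Qed.

Section Normal_form.
Variables (A B C : R -> R -> R) (p : R * R * R) (r : posreal).
Variables g h : R -> R -> R -> R.
Let V := ball p r.
Let D := ball (fst p) r.
Let u0 := snd p.
Hypothesis hA : partially_differentiable V A.
Hypothesis hB : partially_differentiable V B.
Hypothesis hC : partially_differentiable V C.
Hypothesis hA0 : forall t x u, V (t, x, u) -> A t x <> 0.
Hypothesis hg : smooth V g.
Hypothesis hh : smooth V h.
Hypothesis hQ : invariance_criterion A B C V (Operator (fun _ _ _ => 1) g h).

Let g1 (t x : R) : R := g t x u0.
Let g2 (t x : R) : R := pdu h t x u0.
(** The intercept of the affine function u -> h(t, x, u), computed at the centre [u0] because u = 0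
    may lie outside the ball. *)
Let g3 (t x : R) : R := h t x u0 + - u0 * pdu h t x u0.

Lemma ball_slice (t x : R) : D (t, x) -> V (t, x, u0).
Proof. intros H; split; [exact H|apply ball_center]. Qed.

Lemma pdu_g_zero_ball (t x u : R) : V (t, x, u) -> pdu g t x u = 0.
Proof.
assert (H := criterion_tau1 A B C V g h (open_ball_R3 p r) hA hB hC hg hh hA0 hQ).
apply (pdu_g_zero A B C V g h (open_ball_R3 p r) hg hh hA0); intros; apply H; assumption.
Qed.

(** Once g_u = 0, the u_x^2 coefficient reduces to -A h_uu. *)
Lemma pdu_pdu_h_zero_ball (t x u : R) : V (t, x, u) -> pdu (pdu h) t x u = 0.
Proof.
intros Hw.
destruct (criterion_tau1 A B C V g h (open_ball_R3 p r) hA hB hC hg hh hA0 hQ _ _ _ Hw)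
  as (_ & E & _).
destruct (pd_zero V (open_ball_R3 p r) _ _ _ _ pdu_g_zero_ball Hw) as (_ & Z & _).
rewrite Z, pdu_g_zero_ball in E by exact Hw.
assert (A0 := hA0 _ _ _ Hw).
apply Rmult_eq_reg_l with (A t x); [lra|exact A0].
Qed.

Lemma g_eq_slice (t x u : R) : V (t, x, u) -> g t x u = g1 t x.
Proof. apply constant_in_u; [exact hg|exact pdu_g_zero_ball]. Qed.

Lemma h_eq_affine (t x u : R) : V (t, x, u) -> h t x u = g2 t x * u + g3 t x.
Proof.
assert (sh1 := smooth_pdu _ _ hh).
assert (E1 : forall t x u, V (t, x, u) -> pdu h t x u = g2 t x).
{ apply constant_in_u; [exact sh1|exact pdu_pdu_h_zero_ball]. }
assert (hu : smooth V (fun _ _ u => u)).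
{ intros [|k]; [split; [intros; apply continuous_snd|exact I]|].
  split; [intros; apply continuous_snd|].
  split; [intros; repeat split; auto_derive; exact I|].
  repeat split; [apply Ck_ext with (fun _ _ _ => 0)|apply Ck_ext with (fun _ _ _ => 0)
    |apply Ck_ext with (fun _ _ _ => 1)];
  try apply Ck_const; try apply open_ball_R3; intros t' x' u' _; symmetry;
  [exact (Derive_const _ _)|exact (Derive_const _ _)|exact (Derive_id _)]. }
intros Hw.
assert (Hs : smooth V (fun t x u => h t x u + -1 * (pdu h t x u * u))).
{ apply smooth_plus; [apply open_ball_R3|exact hh|].
  apply (smooth_mult V (open_ball_R3 p r) (fun _ _ _ => -1)).
  - apply smooth_const, open_ball_R3.
  - apply (smooth_mult V (open_ball_R3 p r)); assumption. }
assert (E : h t x u + -1 * (pdu h t x u * u) = h t x u0 + -1 * (pdu h t x u0 * u0)).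
{ refine (constant_in_u p r _ Hs _ t x u Hw).
  intros t' x' u' Hw'; unfold pdu at 1; apply is_derive_unique; auto_derive.
  - repeat split; [apply (smooth_ex_derive V h _ _ _ hh Hw')
      |apply (smooth_ex_derive V _ _ _ _ sh1 Hw')].
  - fold (pdu h t' x' u').
    change (Derive (fun x0 => pdu h t' x' x0) u') with (pdu (pdu h) t' x' u').
    rewrite (pdu_pdu_h_zero_ball _ _ _ Hw'); ring. }
unfold g3; rewrite <- (E1 t x u Hw).
assert (E2 := E1 t x u Hw); unfold g2 in E2; fold u0 in E2; rewrite E2 in E |- *; lra.
Qed.

(** On the slice u = u0 the first equation is minus the u_x coefficient of the criterion. The
    constant coefficient is affine in u: its u-derivative is the second equation, and its value
    minus u0 times that derivative is the third. *)
Lemma g_system_ball (t x : R) : D (t, x) -> g_system A B C g1 g2 g3 t x.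
Proof.
intros Hd; assert (Hw := ball_slice _ _ Hd).
assert (hV := open_ball_R3 p r).
assert (H := criterion_tau1 A B C V g h hV hA hB hC hg hh hA0 hQ).
assert (sh1 := smooth_pdu _ _ hh).
assert (shx := smooth_pdx _ _ hh).
assert (sh1x := smooth_pdx _ _ sh1).
assert (ex_u : forall f t x u, smooth V f -> V (t, x, u) ->
  ex_derive (fun s => f t x s) u)
  by (intros; apply (smooth_ex_derive V); assumption).
assert (G : forall f, smooth V f -> (forall t x u, V (t, x, u) -> pdu f t x u = 0) ->
  forall t x u, V (t, x, u) ->
  Derive (fun s => pdt f t x s) u = 0 /\ Derive (fun s => pdx f t x s) u = 0).
{ intros f sf Hf t' x' u' Hw'; split; (etransitivity;
    [apply (pdu_pdt_comm V hV) || apply (pdu_pdx_comm V hV); eassumption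
    |apply (pd_zero V hV); assumption]). }
assert (E3 := proj2 (proj2 (proj2 (H _ _ _ Hw)))).
assert (E1 := proj1 (proj2 (proj2 (H _ _ _ Hw)))).
assert (E2 : pdt (pdu h) t x u0 - A t x * pdx (pdx (pdu h)) t x u0
  - B t x * pdx (pdu h) t x u0
  + (2 * pdx g t x u0 - pdt2 A t x / A t x - g t x u0 * (pdx2 A t x / A t x))
    * (pdu h t x u0 - C t x)
  - pdt2 C t x - g t x u0 * pdx2 C t x = 0).
{ apply (derive_u_zero V hV _ t x u0 _ (fun t x u Hw => proj2 (proj2 (proj2 (H t x u Hw)))) Hw).
  auto_derive.
  { repeat split; apply ex_u; try assumption.
    - apply smooth_pdt, hh.
    - apply smooth_pdx, shx.
    - apply smooth_pdx, hg. }
  destruct (G g hg pdu_g_zero_ball _ _ _ Hw) as (_ & Ggx).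
  assert (Gg : Derive (fun s => g t x s) u0 = 0) by apply (pdu_g_zero_ball _ _ _ Hw).
  assert (Gh1 : Derive (fun s => pdu h t x s) u0 = 0)
    by apply (pdu_pdu_h_zero_ball _ _ _ Hw).
  assert (Ght : Derive (fun s => pdt h t x s) u0 = pdt (pdu h) t x u0)
    by apply (pdu_pdt_comm V hV _ _ _ _ hh Hw).
  assert (Ghx : Derive (fun s => pdx h t x s) u0 = pdx (pdu h) t x u0)
    by apply (pdu_pdx_comm V hV _ _ _ _ hh Hw).
  assert (Ghxx : Derive (fun s => pdx (pdx h) t x s) u0 = pdx (pdx (pdu h)) t x u0).
  { etransitivity; [apply (pdu_pdx_comm V hV _ _ _ _ shx Hw)|].
    apply (pd_ext_open V hV); [|exact Hw].
    intros; apply (pdu_pdx_comm V hV); assumption. }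
  rewrite Gg, Ggx, Gh1, Ght, Ghx, Ghxx.
  unfold Rdiv; fold (pdu h t x u0); ring. }
assert (F1 : pdt2 g3 t x = pdt h t x u0 - u0 * pdt (pdu h) t x u0).
{ unfold pdt2, g3; apply is_derive_unique; auto_derive.
  - repeat split; [apply (smooth_ex_derive V h _ _ _ hh Hw)
      |apply (smooth_ex_derive V _ _ _ _ sh1 Hw)].
  - unfold pdt; ring. }
assert (F2 : forall t x, D (t, x) ->
  pdx2 g3 t x = pdx h t x u0 - u0 * pdx (pdu h) t x u0).
{ intros t' x' Hd'; assert (Hw' := ball_slice _ _ Hd').
  unfold pdx2, g3; apply is_derive_unique; auto_derive.
  - repeat split; [apply (smooth_ex_derive V h _ _ _ hh Hw')
      |apply (smooth_ex_derive V _ _ _ _ sh1 Hw')].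
  - unfold pdx; ring. }
assert (F3 : pdx2 (pdx2 g3) t x = pdx (pdx h) t x u0 - u0 * pdx (pdx (pdu h)) t x u0).
(* The formula [F2] holds only on [D], so it is differentiated through its validity near x. *)
{ unfold pdx2 at 1; transitivity (Derive (fun s => pdx h t s u0 - u0 * pdx (pdu h) t s u0) x).
  - apply Derive_ext_loc.
    generalize (locally_line_x _ _ _ _ (hV _ Hw)); apply filter_imp.
    intros s [Hs _]; apply F2, Hs.
  - apply is_derive_unique; auto_derive.
    + repeat split; [apply (smooth_ex_derive V _ _ _ _ shx Hw)
        |apply (smooth_ex_derive V _ _ _ _ sh1x Hw)].
    + change (pdx (pdx h) t x u0) with (Derive (fun s => pdx h t s u0) x).
      change (pdx (pdx (pdu h)) t x u0) with (Derive (fun s => pdx (pdu h) t s u0) x).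
      ring. }
assert (Z1 := pdu_g_zero_ball _ _ _ Hw).
unfold g_system, g_factor; rewrite F1, F2, F3 by exact Hd.
change (pdt2 g1 t x) with (pdt g t x u0).
change (pdx2 g1 t x) with (pdx g t x u0).
change (pdx2 (pdx2 g1) t x) with (pdx (pdx g) t x u0).
change (g1 t x) with (g t x u0).
change (pdt2 g2 t x) with (pdt (pdu h) t x u0).
change (pdx2 g2 t x) with (pdx (pdu h) t x u0).
change (pdx2 (pdx2 g2) t x) with (pdx (pdx (pdu h)) t x u0).
change (g2 t x) with (pdu h t x u0).
unfold g3; rewrite Z1 in E1.
unfold Rdiv in *; split; [|split].
- rewrite <- Ropp_0, <- E1; ring.
- etransitivity; [|exact E2]; ring.
- transitivity (0 - u0 * 0); [|ring].
  etransitivity; [|exact (f_equal2 (fun a b => a - u0 * b) E3 E2)]; cbv beta; ring.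
Qed.

Lemma smooth_g_slices : smooth2 D g1 /\ smooth2 D g2 /\ smooth2 D g3.
Proof.
assert (hD := open_ball_R2 (fst p) r).
assert (S : forall f, smooth V f -> smooth2 D (fun t x => f t x u0)).
{ intros f; apply smooth2_slice; [exact hD|exact ball_slice]. }
split; [|split]; [apply S, hg|apply (S (pdu h)), smooth_pdu, hh|].
apply (S (fun t x u => h t x u + - u0 * pdu h t x u)).
apply smooth_plus; [apply open_ball_R3|exact hh|].
apply (smooth_mult V (open_ball_R3 p r) (fun _ _ _ => - u0)).
- apply smooth_const, open_ball_R3.
- apply smooth_pdu, hh.
Qed.

End Normal_form.

(** * Localization and the two cases *)

Theorem lemma5 (D : R * R -> Prop) (A B C : R -> R -> R)
    (W : R * R * R -> Prop) (Q : operator)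
    (hD : open D)
    (hA : analytic2 D A) (hB : analytic2 D B) (hC : analytic2 D C)
    (hA0 : forall t x, D (t, x) -> A t x <> 0)
    (hW : open W) (hWD : forall t x u, W (t, x, u) -> D (t, x))
    (hQ : reduction_operator A B C W Q) :
  forall (t0 x0 u0 : R) (eps : posreal),
    W (t0, x0, u0) ->
    (tau Q t0 x0 u0 <> 0 \/ xi Q t0 x0 u0 <> 0) ->
  exists (p : R * R * R) (r : posreal),
    (forall q, ball p r q -> W q /\ ball (t0, x0, u0) eps q) /\
    ((exists g1 g2 g3 : R -> R -> R,
        smooth2 (ball (fst p) r) g1 /\
        smooth2 (ball (fst p) r) g2 /\
        smooth2 (ball (fst p) r) g3 /\
        equivalent_on (ball p r) Q
          (Operator (fun _ _ _ => 1)
                    (fun t x _ => g1 t x)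
                    (fun t x u => g2 t x * u + g3 t x)) /\
        forall t x, ball (fst p) r (t, x) -> g_system A B C g1 g2 g3 t x)
     \/
     (exists h : R -> R -> R -> R,
        smooth (ball p r) h /\
        equivalent_on (ball p r) Q
          (Operator (fun _ _ _ => 0) (fun _ _ _ => 1) h) /\
        forall t x u, ball p r (t, x, u) -> eta_equation A B C h t x u)).
Proof.
intros t0 x0 u0 eps Hw0 Hn.
destruct hQ as (ht & hx & he & _ & hinv).
assert (hloc : forall q, W q /\ ball (t0, x0, u0) eps q ->
  locally q (fun q => W q /\ ball (t0, x0, u0) eps q)).
{ intros q [H1 H2]; apply filter_and; [apply hW, H1|].
  apply (open_ball_R3 _ _ _ H2). }
assert (hdiff : forall V f, (forall q, V q -> W q) -> analytic2 D f ->
  partially_differentiable V f).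
{ intros V f HV hf t x u Hv; eapply analytic2_ex_derive; [exact hf|].
  eapply hWD, HV, Hv. }
(* The split asks whether tau is nonzero anywhere near the given point, not at it. A positive answer
   moves the centre to such a point; a negative one makes tau vanish identically nearby. *)
destruct (classic (exists t x u, (W (t, x, u) /\ ball (t0, x0, u0) eps (t, x, u))
  /\ tau Q t x u <> 0)) as [(t & x & u & Hw & Hne)|Hz].
- destruct (filter_and _ _ (hloc _ Hw) (locally_neq_zero _ _ _ _ _ ht (proj1 Hw) Hne))
    as [r Hr].
  set (p := (t, x, u)) in Hr |- *.
  assert (HV : forall q, ball p r q -> W q) by (intros q Hq; apply Hr, Hq).
  assert (hV := open_ball_R3 p r).
  assert (N : forall t x u, ball p r (t, x, u) -> tau Q t x u <> 0)
    by (intros t' x' u' Hq; apply (Hr _ Hq)).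
  assert (sl := smooth_inv _ hV _ N (smooth_mono _ _ _ HV ht)).
  set (g := fun t x u => / tau Q t x u * xi Q t x u).
  set (h := fun t x u => / tau Q t x u * eta Q t x u).
  assert (sg : smooth (ball p r) g)
    by apply (smooth_mult _ hV _ _ sl (smooth_mono _ _ _ HV hx)).
  assert (sh : smooth (ball p r) h)
    by apply (smooth_mult _ hV _ _ sl (smooth_mono _ _ _ HV he)).
  assert (A0 : forall t x u, ball p r (t, x, u) -> A t x <> 0)
    by (intros t' x' u' Hq; eapply hA0, hWD, HV, Hq).
  assert (dA := hdiff _ _ HV hA). assert (dB := hdiff _ _ HV hB).
  assert (dC := hdiff _ _ HV hC).
  assert (Eq : equivalent_on (ball p r) Q (Operator (fun _ _ _ => 1) g h)).
  { exists (fun t x u => / tau Q t x u); split; [exact sl|].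
    intros t' x' u' Hq; assert (N' := N _ _ _ Hq); simpl.
    split; [apply Rinv_neq_0_compat, N'|].
    split; [field; exact N'|split; reflexivity]. }
  assert (Inv : invariance_criterion A B C (ball p r) (Operator (fun _ _ _ => 1) g h)).
  { apply (invariance_criterion_equivalent A B C _ Q); try assumption.
    - split; [|split]; apply (smooth_mono _ W); assumption.
    - split; [|split]; simpl; [apply smooth_const, hV|exact sg|exact sh].
    - intros t' x' u' ut ux utt utx uxx Hq; apply hinv, HV, Hq. }
  exists p, r; split; [intros q Hq; apply Hr, Hq|left].
  destruct (smooth_g_slices p r g h sg sh) as (S1 & S2 & S3).
  do 3 eexists; split; [exact S1|split; [exact S2|split; [exact S3|split]]].
  (* The multiplier 1/tau is kept, since on the ball g and h coincide with g1 and g2 u + g3. *)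
  + destruct Eq as (l & Hl & El); exists l; split; [exact Hl|].
    intros t' x' u' Hq; destruct (El _ _ _ Hq) as (L0 & L1 & L2 & L3); simpl in *.
    split; [exact L0|split; [exact L1|split]].
    * rewrite <- L2; symmetry; apply (g_eq_slice A B C p r g h); assumption.
    * rewrite <- L3; symmetry; apply (h_eq_affine A B C p r g h); assumption.
  + apply g_system_ball; assumption.
(* As tau vanishes at the given point, the nondegeneracy assumed there falls on xi, and the ball can
   keep that point as its centre. *)
- assert (Hx0 : xi Q t0 x0 u0 <> 0).
  { destruct Hn as [Hn|Hn]; [|exact Hn].
    destruct Hz; exists t0, x0, u0; repeat split; auto using ball_center. }
  destruct (filter_and _ _ (hloc _ (conj Hw0 (ball_center _ eps)))
    (locally_neq_zero _ _ _ _ _ hx Hw0 Hx0)) as [r Hr].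
  set (p := (t0, x0, u0)) in Hr |- *.
  assert (HV : forall q, ball p r q -> W q) by (intros q Hq; apply Hr, Hq).
  assert (hV := open_ball_R3 p r).
  assert (N : forall t x u, ball p r (t, x, u) -> xi Q t x u <> 0)
    by (intros t' x' u' Hq; apply (Hr _ Hq)).
  assert (Z : forall t x u, ball p r (t, x, u) -> tau Q t x u = 0).
  { intros t x u Hq; apply NNPP; intros Hne; apply Hz; exists t, x, u.
    split; [apply (Hr _ Hq)|exact Hne]. }
  assert (sl := smooth_inv _ hV _ N (smooth_mono _ _ _ HV hx)).
  set (h := fun t x u => / xi Q t x u * eta Q t x u).
  assert (sh : smooth (ball p r) h)
    by apply (smooth_mult _ hV _ _ sl (smooth_mono _ _ _ HV he)).
  assert (dA := hdiff _ _ HV hA). assert (dB := hdiff _ _ HV hB).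
  assert (dC := hdiff _ _ HV hC).
  assert (Eq : equivalent_on (ball p r) Q
    (Operator (fun _ _ _ => 0) (fun _ _ _ => 1) h)).
  { exists (fun t x u => / xi Q t x u); split; [exact sl|].
    intros t' x' u' Hq; assert (N' := N _ _ _ Hq); simpl.
    split; [apply Rinv_neq_0_compat, N'|].
    split; [rewrite (Z _ _ _ Hq); ring|split; [field; exact N'|reflexivity]]. }
  exists p, r; split; [intros q Hq; apply Hr, Hq|right].
  exists h; split; [exact sh|split; [exact Eq|]].
  apply (criterion_tau0 A B C (ball p r)); try assumption.
  apply (invariance_criterion_equivalent A B C _ Q); try assumption.
  + split; [|split]; apply (smooth_mono _ W); assumption.
  + split; [|split]; simpl; [apply smooth_const, hV|apply smooth_const, hV|exact sh].
  + intros t' x' u' ut ux utt utx uxx Hq; apply hinv, HV, Hq.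
Qed.
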